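(* Let $\mathcal{F}$ be any class of languages of finite words that contains all definite languages. Then the $\mathcal{F}$ separability problem for languages of one counter automata is undecidable; that is, there is no algorithm which, given two one counter automata $\mathcal{A}$ and $\mathcal{B}$ over the same finite alphabet $\Sigma$, decides whether there is a language $S \in \mathcal{F}$ (over $\Sigma$) with $L(\mathcal{A}) \subseteq S$ and $L(\mathcal{B}) \cap S = \emptyset$.
   Context: A language over a finite alphabet $\Sigma$ is definite if it is a finite Boolean combination of languages of the form $w\Sigma^*$ with $w \in \Sigma^*$. Write $\Sigma_\varepsilon = \Sigma \cup \{\varepsilon\}$. A one counter automaton (OCA) over $\Sigma$ is a tuple $\mathcal{A} = (Q, \alpha_0, \alpha_f, T, T_{=0})$ where $Q$ is a finite set of control states, $\alpha_0 = (q_0,n_0)$ and $\alpha_f=(q_f,n_f)$ are the initial and final configurations (configurations are pairs in $Q\times\mathbb{N}$), $T \subseteq Q \times \Sigma_\varepsilon \times Q \times \mathbb{Z}$ is a finite set of transitions, and $T_{=0} \subseteq Q \times \Sigma_\varepsilon \times Q$ is a set of zero tests. A transition $(q,a,q',z)$ can be fired in $(q,n)$ if $n+z\ge 0$, leading to $(q',n+z)$; a zero test $(q,a,q')$ can be fired in $(q,n)$ only if $n=0$, leading to $(q',0)$. In both cases one writes $\alpha \xrightarrow{a} \alpha'$. A run over $w \in \Sigma^*$ is a sequence $\alpha_0 \xrightarrow{a_1} \alpha_1 \cdots \xrightarrow{a_m} \alpha_m$ such that removing all $\varepsilon$ from $a_1\cdots a_m$ yields $w$; it is accepting if it starts in the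 initial and ends in the final configuration. $L(\mathcal{A})$ is the set of words over which $\mathcal{A}$ has an accepting run. *)

(* Defs.v *)
From mathcomp Require Import all_boot all_order all_algebra.
From mathcomp Require Import classical_sets.

Set Implicit Arguments.
Unset Strict Implicit.
Unset Printing Implicit Defensive.

Local Open Scope classical_set_scope.
Local Open Scope nat_scope.

Definition language (Sigma : finType) := set (seq Sigma).

Inductive definite (Sigma : finType) : set (language Sigma) :=
| definite_cylinder (w : seq Sigma) :
    definite [set w ++ v | v in [set: seq Sigma]]
| definite_setC (K : language Sigma) : definite K -> definite (~` K)
| definite_setU (K L : language Sigma) :
    definite K -> definite L -> definite (K `|` L)
| definite_setI (K L : language Sigma) :
    definite K -> definite L -> definite (K `&` L).

Definition separable (Sigma : finType) (F : set (language Sigma))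
    (K L : language Sigma) : Prop :=
  exists S : language Sigma, [/\ F S, K `<=` S & L `&` S = set0].

(* The finite sets of transitions and of zero tests are given by listing their
   elements; a label [None] stands for the empty word. *)
Record oca (Q Sigma : finType) := Oca {
  oca_init : Q * nat;
  oca_final : Q * nat;
  oca_trans : seq (Q * option Sigma * Q * int);
  oca_ztests : seq (Q * option Sigma * Q)
}.

Definition oca_fire (Q Sigma : finType) (A : oca Q Sigma)
    (c : Q * nat) (a : option Sigma) (c' : Q * nat) : Prop :=
  (exists2 z : int, (c.1, a, c'.1, z) \in oca_trans A
                  & Posz c'.2 = (Posz c.2 + z)%R)
  \/ [/\ (c.1, a, c'.1) \in oca_ztests A, c.2 = 0 & c'.2 = 0].

Inductive oca_run (Q Sigma : finType) (A : oca Q Sigma) :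
    Q * nat -> seq (option Sigma) -> Q * nat -> Prop :=
| oca_run_nil c : oca_run A c [::] c
| oca_run_cons c a c' s c'' :
    oca_fire A c a c' -> oca_run A c' s c'' -> oca_run A c (a :: s) c''.

(* [pmap id] erases the labels [None]. *)
Definition oca_lang (Q Sigma : finType) (A : oca Q Sigma) : language Sigma :=
  [set w | exists2 s, oca_run A (oca_init A) s (oca_final A) & pmap id s = w].

(* Algorithms are Minsky register machines, with any finite number of
   registers.  [Inc r j] increments register r and jumps to line j; [Dec r j k]
   decrements register r and jumps to line j if that register is positive, and
   jumps to line k otherwise. *)
Inductive instr :=
| Inc of nat & nat
| Dec of nat & nat & nat.

Definition program := seq instr.

(* The current line and the contents of the registers. *)
Definition mconfig := (nat * (nat -> nat))%type.

Definition upd (R : nat -> nat) (r v : nat) : nat -> nat :=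
  fun s => if s == r then v else R s.

Definition mstep (p : program) (c : mconfig) : mconfig :=
  let: (i, R) := c in
  match onth p i with
  | Some (Inc r j) => (j, upd R r (R r).+1)
  | Some (Dec r j k) => if R r is n.+1 then (j, upd R r n) else (k, R)
  | None => c
  end.

(* The machine starts at line 0 with x in register 0 and all other registers
   empty; it halts when it leaves the program, with its result in register 0. *)
Definition outputs (p : program) (x y : nat) : Prop :=
  exists t : nat,
    let c := iter t (mstep p) (0, upd (fun=> 0) 0 x) in
    size p <= c.1 /\ c.2 0 = y.

Definition algorithmically_decidable (I : Type) (code : I -> nat)
    (P : I -> Prop) : Prop :=
  exists p : program, forall x : I,
    exists b : bool, outputs p (code x) b /\ (P x <-> b).

(* Inputs of the separability problem: the alphabet and the sets of states are
   initial segments of the natural numbers, so that an input is a finite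
   object. *)
Record oca_pair := OcaPair {
  alphabet_size : nat;
  fst_states : nat;
  snd_states : nat;
  fst_oca : oca 'I_fst_states 'I_alphabet_size;
  snd_oca : oca 'I_snd_states 'I_alphabet_size
}.

Definition code_int (z : int) : nat :=
  match z with Posz n => n.*2 | Negz n => n.*2.+1 end.

Definition code_label (k : nat) (a : option 'I_k) : nat :=
  if a is Some x then x.+1 else 0.

Definition code_trans (m k : nat) (t : 'I_m * option 'I_k * 'I_m * int) : nat :=
  let: (q, a, q', z) := t in
  CodeSeq.code [:: val q; code_label a; val q'; code_int z].

Definition code_ztest (m k : nat) (t : 'I_m * option 'I_k * 'I_m) : nat :=
  let: (q, a, q') := t in
  CodeSeq.code [:: val q; code_label a; val q'].

Definition code_oca (m k : nat) (A : oca 'I_m 'I_k) : nat :=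
  CodeSeq.code [:: m;
    val (oca_init A).1; (oca_init A).2;
    val (oca_final A).1; (oca_final A).2;
    CodeSeq.code (map (@code_trans m k) (oca_trans A));
    CodeSeq.code (map (@code_ztest m k) (oca_ztests A))].

Definition code_oca_pair (I : oca_pair) : nat :=
  CodeSeq.code [:: alphabet_size I; code_oca (fst_oca I); code_oca (snd_oca I)].

(* Main.v *)
(* Diagonalisation.  A deterministic two-counter machine yields two one counter
   automata reading the same sequence of steps, each following one counter.  If
   the machine halts in the final configuration, the sequence of its steps lies
   in both languages, which are then inseparable.  If it halts elsewhere after t
   steps, no words of the two languages agree on their first t + 1 letters, so
   the languages are separated by a definite one.  Given a program p deciding
   separability, let the machine compute the code of its own instance, run p on
   it, and halt in the final configuration exactly when p answers yes.  The
   constants of its own code are not part of the program but of the initial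
   counter value, which encodes registers by prime powers. *)
Require Import Defs.
From mathcomp Require Import all_boot all_order all_algebra.
From mathcomp Require Import boolp classical_sets.
From mathcomp Require Import zify.

Set Implicit Arguments.
Unset Strict Implicit.
Unset Printing Implicit Defensive.

Local Open Scope classical_set_scope.
Local Open Scope nat_scope.

(** * Separation by prefixes *)

Section Definite.
Variable Sigma : finType.
Implicit Types (K L : language Sigma) (u v w : seq Sigma).

(** The empty union has no constructor in [definite]; it is a cylinder intersected with its own
    complement. *)
Lemma definite_bigcup (s : seq Sigma) (K : Sigma -> language Sigma) :
  (forall a, definite (K a)) -> definite [set w | exists2 a, a \in s & K a w].
Proof.
move=> defK; elim: s => [|a s IH].
  suff -> : [set w | exists2 a, a \in [::] & K a w] =
    [set [::] ++ v | v in setT] `&` ~` [set [::] ++ v | v in setT].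
    by apply: definite_setI; [|apply: definite_setC]; exact: definite_cylinder.
  by rewrite setICr; apply/seteqP; split=> w // [].
suff -> : [set w | exists2 b, b \in a :: s & K b w] =
    K a `|` [set w | exists2 b, b \in s & K b w] by exact: definite_setU.
apply/seteqP; split=> w.
  move=> [b]; rewrite inE => /orP[/eqP->|bs] Kw; [by left|by right; exists b].
case=> [Kw|[b bs Kw]]; first by exists a; rewrite ?mem_head.
by exists b; rewrite // inE bs orbT.
Qed.

(** Induction on [N], peeling off the letter that follows [u], so [u] must vary. The word [u] itself
    has no such letter and is treated apart. *)
Lemma definite_prefix N (X : set (seq Sigma)) u :
  definite [set u ++ v | v in [set v | X (take N v)]].
Proof.
have cyl u' : definite [set u' ++ v | v in setT] by exact: definite_cylinder.
elim: N X u => [|N IH] X u.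
  have [X0|X0] := pselect (X [::]).
    suff -> : [set u ++ v | v in [set v | X (take 0 v)]] =
      [set u ++ v | v in setT] by [].
    by apply/seteqP; split=> w [v] ? <-; exists v => //=; rewrite take0.
  suff -> : [set u ++ v | v in [set v | X (take 0 v)]] =
      [set u ++ v | v in setT] `&` ~` [set u ++ v | v in setT].
    by apply: definite_setI => //; exact: definite_setC.
  by rewrite setICr; apply/seteqP; split=> w // [v] /=; rewrite take0.
pose longer P := [set w | exists2 a, a \in enum Sigma &
  [set rcons u a ++ v | v in [set v | P a (take N v)]] w].
have def_longer P : definite (longer P) by apply: definite_bigcup => a; exact: IH.
have longerX v : longer (fun a s => X (a :: s)) (u ++ v) <->
    v <> [::] /\ X (take N.+1 v).
  split=> [[a _ [v' Xv]]|[]].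
    by rewrite cat_rcons => /eqP; rewrite eqseq_cat // eqxx => /eqP <-.
  case: v => [//|a v] _ Xv; exists a; first by rewrite mem_enum.
  by exists v; rewrite ?cat_rcons.
have [X0|X0] := pselect (X [::]).
  (* [longer (fun=> setT)] consists of the proper extensions of [u], so the last term is the
     singleton of [u]. *)
  suff -> : [set u ++ v | v in [set v | X (take N.+1 v)]] =
      longer (fun a s => X (a :: s)) `|`
      ([set u ++ v | v in setT] `&` ~` longer (fun=> setT)).
    apply: definite_setU => //; apply: definite_setI => //.
    exact: definite_setC.
  apply/seteqP; split=> w.
    move=> [[|a v] /= Xv <-]; last by left; apply/longerX.
    right; split; first by exists [::].
    by case=> a _ [v _] /(congr1 size); rewrite cats0 size_cat size_rcons; lia.
  case.
    case=> a _ [v Xv <-]; exists (a :: v); last by rewrite cat_rcons.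
    exact: Xv.
  case=> -[[|a v] _ <-] nl; first by exists [::].
  case: nl; exists a; first by rewrite mem_enum.
  by exists v; rewrite ?cat_rcons.
suff -> : [set u ++ v | v in [set v | X (take N.+1 v)]] =
    longer (fun a s => X (a :: s)) by [].
apply/seteqP; split=> w.
  by move=> [[|a v] /= Xv <-] //; apply/longerX.
case=> a _ [v Xv <-]; exists (a :: v); last by rewrite cat_rcons.
exact: Xv.
Qed.

(** The separator consists of the words that agree with some word of [K] on their first [N]
    letters. *)
Lemma separable_prefix (F : set (language Sigma)) K L N :
  @definite Sigma `<=` F ->
  (forall x y, K x -> L y -> take N x <> take N y) -> separable F K L.
Proof.
move=> defF KL.
pose X := [set take N x | x in K].
exists [set [::] ++ v | v in [set v | X (take N v)]]; split.
- by apply: defF; exact: definite_prefix.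
- by move=> x Kx; exists x => //; exists x.
- apply/seteqP; split=> // y [Ly [v [x Kx xv]] vy].
  by apply: (KL x y) => //; rewrite xv -vy.
Qed.

End Definite.

(** * Deterministic two-counter machines *)

Inductive star (C : Type) (f : C -> option C) : C -> C -> Prop :=
| star_refl c : star f c c
| star_step c c1 c2 : f c = Some c1 -> star f c1 c2 -> star f c c2.

Lemma star_trans C (f : C -> option C) c1 c2 c3 :
  star f c1 c2 -> star f c2 c3 -> star f c1 c3.
Proof. by elim=> // c c' c'' fc _ IH /IH; exact: star_step. Qed.

Lemma star_step1 C (f : C -> option C) c c' : f c = Some c' -> star f c c'.
Proof. by move=> fc; apply: star_step fc _; exact: star_refl. Qed.

Lemma star_simulation C D (f : C -> option C) (g : D -> option D) (e : C -> D) :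
  (forall c c', f c = Some c' -> star g (e c) (e c')) ->
  forall c c', star f c c' -> star g (e c) (e c').
Proof.
move=> sim c c'; elim=> [d|d d1 d2 /sim fd _ IH]; first exact: star_refl.
exact: star_trans fd IH.
Qed.

(* [M q = Some (s, (q1, z1), (q0, z0))] tests the first ([s = true]) or the
   second ([s = false]) counter: if it is positive it is decremented, z1 is
   added to the other counter and the machine moves to q1; otherwise z0 is added
   to the other counter and the machine moves to q0. *)
Definition machine (Q : Type) := Q -> option (bool * (Q * nat) * (Q * nat)).

Section TwoCounter.
Variables (Q : finType) (M : machine Q).

Definition tstep (c : Q * nat * nat) : option (Q * nat * nat) :=
  let: (q, a, b) := c in
  match M q with
  | Some (true, (q1, z1), (q0, z0)) =>
      Some (if a is a'.+1 then (q1, a', b + z1) else (q0, 0, b + z0))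
  | Some (false, (q1, z1), (q0, z0)) =>
      Some (if b is b'.+1 then (q1, a + z1, b') else (q0, a + z0, 0))
  | None => None
  end.

(** * One counter automata following a single counter *)

Local Notation st := (fun q : Q => enum_rank q).
Local Notation lab := (fun (q : Q) (b : bool) => Some (enum_rank (q, b))).

(** An automaton that does not follow the tested counter cannot see the outcome of the test, so it
    offers both. On the tested counter, adding [Negz 0], that is -1, forces positivity. *)
Definition side_trans (s : bool) (q : Q) :
    seq ('I_#|Q| * option 'I_#|{: Q * bool}| * 'I_#|Q| * int) :=
  if M q is Some (s', (q1, z1), (q0, z0)) then
    if s == s' then [:: (st q, lab q true, st q1, Negz 0)]
    else [:: (st q, lab q true, st q1, Posz z1);
             (st q, lab q false, st q0, Posz z0)]
  else [::].

Definition side_ztests (s : bool) (q : Q) :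
    seq ('I_#|Q| * option 'I_#|{: Q * bool}| * 'I_#|Q|) :=
  if M q is Some (s', _, (q0, _)) then
    if s == s' then [:: (st q, lab q false, st q0)] else [::]
  else [::].

(* The letter [(q, b)] records a step from state q in which the tested counter
   is positive exactly when b is true; [side true] follows the first counter
   along such a word and [side false] the second one. *)
Definition side (s : bool) (q0 : Q) (n : nat) (qf : Q) :
    oca 'I_#|Q| 'I_#|{: Q * bool}| :=
  Oca (st q0, n) (st qf, 0)
      (flatten [seq side_trans s q | q <- enum Q])
      (flatten [seq side_ztests s q | q <- enum Q]).

Definition side_step (s : bool) (q : Q) (n : nat) (b : bool) :
    option (Q * nat) :=
  if M q is Some (s', (q1, z1), (q0, z0)) then
    if b then
      if s == s' then if n is n'.+1 then Some (q1, n') else None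
      else Some (q1, n + z1)
    else
      if s == s' then if n == 0 then Some (q0, 0) else None
      else Some (q0, n + z0)
  else None.

Lemma side_fireP s q0 n0 qf q n l c' :
  oca_fire (side s q0 n0 qf) (st q, n) l c' <->
  exists b q' n', [/\ side_step s q n b = Some (q', n'), l = lab q b &
                      c' = (st q', n')].
Proof.
case: c' => p' n'; split.
- case=> /= [[z /flatten_mapP[p _]]|[/flatten_mapP[p _]]].
    rewrite /side_trans /side_step.
    case Mp: (M p) => [[[s' [q1 z1]] [q2 z2]]|] //.
    case: (eqVneq s s') => [ss|ns]; rewrite !inE.
      move=> /eqP[/enum_rank_inj qp -> -> ->] e; subst p.
      exists true, q1, n'; rewrite Mp ss eqxx; split=> //.
      by case: n e => [|n] e; [lia|have -> : n = n' by lia].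
    move=> /orP[]/eqP[/enum_rank_inj qp -> -> ->] e; subst p.
      exists true, q1, n'; rewrite Mp (negPf ns); split=> //.
      by have -> : n' = n + z1 by lia.
    exists false, q2, n'; rewrite Mp (negPf ns); split=> //.
    by have -> : n' = n + z2 by lia.
  rewrite /side_ztests /side_step.
  case Mp: (M p) => [[[s' [q1 z1]] [q2 z2]]|] //.
  case: (eqVneq s s') => [ss|ns]; rewrite !inE //.
  move=> /eqP[/enum_rank_inj qp -> ->] -> ->; subst p.
  by exists false, q2, 0; rewrite Mp ss eqxx.
- case=> b [q' [m]] []; rewrite /side_step.
  case Mq: (M q) => [[[s' [q1 z1]] [q2 z2]]|] // e -> [-> ->] {p' n' l}.
  have inT x : x \in side_trans s q ->
      x \in oca_trans (side s q0 n0 qf).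
    by move=> xq; apply/flatten_mapP; exists q; rewrite ?mem_enum.
  have inZ x : x \in side_ztests s q ->
      x \in oca_ztests (side s q0 n0 qf).
    by move=> xq; apply/flatten_mapP; exists q; rewrite ?mem_enum.
  case: b e; case: eqVneq => [ss|ns].
  + case: n => // n [<- <-]; left; exists (Negz 0) => /=; last lia.
    by apply: inT; rewrite /side_trans Mq ss eqxx mem_head.
  + move=> [<- <-]; left; exists (Posz z1) => //=.
    by apply: inT; rewrite /side_trans Mq (negPf ns) mem_head.
  + case: eqP => // -> [<- <-]; right; split=> //=.
    by apply: inZ; rewrite /side_ztests Mq ss eqxx mem_head.
  + move=> [<- <-]; left; exists (Posz z2) => //=.
    by apply: inT; rewrite /side_trans Mq (negPf ns) !inE eqxx orbT.
Qed.

(** The side holding the tested counter certifies the bit [t], and the other side performs the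
    addition; a letter accepted by both is therefore a genuine step. *)
Lemma side_step_joint q a b t qa a' qb b' :
  side_step true q a t = Some (qa, a') ->
  side_step false q b t = Some (qb, b') ->
  qa = qb /\ tstep (q, a, b) = Some (qa, a', b').
Proof.
rewrite /side_step /tstep.
case: (M q) => [[[[] [q1 z1]] [q2 z2]]|] //=; case: t.
- by case: a => // a [<- <-] [<- <-].
- by case: a => // -[<- <-] [<- <-].
- by case: b => // b [<- <-] [<- <-].
- by case: b => // -[<- <-] [<- <-].
Qed.

Lemma tstep_sides q a b q' a' b' :
  tstep (q, a, b) = Some (q', a', b') ->
  exists t, side_step true q a t = Some (q', a') /\
            side_step false q b t = Some (q', b').
Proof.
rewrite /side_step /tstep.
case: (M q) => [[[[] [q1 z1]] [q2 z2]]|] //=.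
- by case: a => [|a] [<- <- <-]; [exists false|exists true].
- by case: b => [|b] [<- <- <-]; [exists false|exists true].
Qed.

(** No transition or zero test of [side] is labelled by the empty word, so each step of a run reads
    exactly one letter. *)
Lemma side_run_cases s q0 n0 qf q n r :
  oca_run (side s q0 n0 qf) (st q, n) r (st qf, 0) ->
  match pmap id r with
  | [::] => q = qf
  | l :: w => exists t q' n' r', [/\ side_step s q n t = Some (q', n'),
      l = enum_rank (q, t), pmap id r' = w &
      oca_run (side s q0 n0 qf) (st q', n') r' (st qf, 0)]
  end.
Proof.
move=> run; inversion run as [c e1 e2 e3|c l c' r' c'' fire run' e1 e2 e3]; subst.
  by rewrite /=; apply/enum_rank_inj; case: e3.
have /side_fireP[t [q' [n' [step -> e]]]] := fire.
by rewrite /=; exists t, q', n', r'; rewrite -e.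
Qed.

Lemma star_common_word q0 n m qf c :
  star tstep c (qf, 0, 0) ->
  exists r, oca_run (side true q0 n qf) (st c.1.1, c.1.2) r (st qf, 0) /\
            oca_run (side false q0 m qf) (st c.1.1, c.2) r (st qf, 0).
Proof.
move e: (qf, 0, 0) => cf run; elim: run e => [{}c <-|].
  by exists [::]; split; exact: oca_run_nil.
move=> [[q a] b] [[q' a'] b'] c2 /tstep_sides[t [sa sb]] _ /[apply] -[r [ra rb]].
exists (lab q t :: r); split; [move: ra|move: rb]; apply: oca_run_cons.
  by apply/side_fireP; exists t, q', a'.
by apply/side_fireP; exists t, q', b'.
Qed.

(** As long as their letters agree, both automata are forced to follow the run of the machine. At
    its end [d] no letter can be read, and the state is not final. *)
Lemma star_no_common_prefix q0 n m qf c d :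
  star tstep c d -> tstep d = None -> d.1.1 != qf -> M qf = None ->
  exists N, forall r1 r2,
    oca_run (side true q0 n qf) (st c.1.1, c.1.2) r1 (st qf, 0) ->
    oca_run (side false q0 m qf) (st c.1.1, c.2) r2 (st qf, 0) ->
    take N (pmap id r1) <> take N (pmap id r2).
Proof.
move=> run stuck dqf Mqf; elim: run stuck dqf => {c d}.
- move=> [[q a] b] stuck /= qqf; exists 1 => r1 r2 /side_run_cases run1 _.
  case: (pmap id r1) run1 => [qf_|l w]; first by rewrite qf_ eqxx in qqf.
  case=> t [q' [n' [r' []]]]; rewrite /side_step; move: stuck => /=.
  by case: (M q) => // -[[[] []]] ? ? [].
- move=> [[q a] b] [[q' a'] b'] c2 step _ IH /IH/[apply] -[N NP].
  exists N.+1 => r1 r2 /side_run_cases run1 /side_run_cases run2.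
  (* The machine still moves at [q] but stops at [qf], so neither word can end here. *)
  have qqf : q <> qf by move=> e; move: step; rewrite /= e Mqf.
  case: (pmap id r1) run1 => // l1 w1 [t1 [q1 [a1 [r1' [step1 -> <- run1]]]]].
  case: (pmap id r2) run2 => // l2 w2 [t2 [q2 [b2 [r2' [step2 -> <- run2]]]]].
  case=> /enum_rank_inj[tt]; subst t2.
  have [qq] := side_step_joint step1 step2; rewrite step => -[? ? ?]; subst.
  exact: NP.
Qed.

Definition side_pair (q0 : Q) (n : nat) (qf : Q) : oca_pair :=
  OcaPair (side true q0 n qf) (side false q0 0 qf).

Variable F : forall Sigma : finType, set (language Sigma).

Lemma accept_not_separable q0 n qf : star tstep (q0, n, 0) (qf, 0, 0) ->
  ~ separable (@F 'I_(alphabet_size (side_pair q0 n qf)))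
      (oca_lang (fst_oca (side_pair q0 n qf)))
      (oca_lang (snd_oca (side_pair q0 n qf))).
Proof.
move=> /(star_common_word q0 n 0)[r [ra rb]] [S [_ sub /seteqP[disj _]]].
by apply: (disj (pmap id r)); split; [exists r|apply: sub; exists r].
Qed.

Lemma reject_separable q0 n qf d :
  (forall Sigma : finType, @definite Sigma `<=` @F Sigma) ->
  star tstep (q0, n, 0) d -> tstep d = None -> d.1.1 != qf -> M qf = None ->
  separable (@F 'I_(alphabet_size (side_pair q0 n qf)))
      (oca_lang (fst_oca (side_pair q0 n qf)))
      (oca_lang (snd_oca (side_pair q0 n qf))).
Proof.
move=> defF run stuck dqf Mqf.
have [N NP] := star_no_common_prefix q0 n 0 run stuck dqf Mqf.
apply: (@separable_prefix _ _ _ _ N) => // x y [r1 run1 <-] [r2 run2 <-].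
exact: NP.
Qed.

End TwoCounter.

(** * Fraction machines *)

(* At line (P, c, j, k) the single register N becomes (N / P) * c and control
   passes to line j if P divides N; otherwise control passes to line k. *)
Definition fractions := seq (nat * nat * nat * nat).

Definition fstep (p : fractions) (x : nat * nat) : option (nat * nat) :=
  let: (i, N) := x in
  if onth p i is Some (P, c, j, k) then
    Some (if P %| N then (j, N %/ P * c) else (k, N))
  else None.

Section TwoCounterFractions.
Variables (p : fractions) (W : nat).
Hypothesis pW : all (fun l => 0 < l.1.1.1 <= W.+1) p.

(* Control state (i, false, u): the first counter is being divided by P into the
   second one, and u has been subtracted since the last complete P.
   Control state (i, true, u): the second counter is being multiplied back into
   the first one, u being the remainder of the division. *)
Local Notation fstate := ('I_(size p).+2 * bool * 'I_W.+1)%type.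

(** The bound [(size p).+2] leaves two distinct halting lines after the program. On the way back,
    remainder 0 means that [P] divides the register, and each unit of the quotient yields [c];
    otherwise it yields [P], and adding [u] at the end restores the old value. *)
Definition fmachine : machine fstate := fun q =>
  let: (i, back, u) := q in
  if onth p i is Some (P, c, j, k) then
    if back then
      Some (false, ((i, true, u), if u == ord0 then c else P),
            ((inord (if u == ord0 then j else k), false, ord0), val u))
    else
      Some (true, ((i, false, inord (if u.+1 == P then 0 else u.+1)),
                   nat_of_bool (u.+1 == P)),
            ((i, true, u), 0))
  else None.

Definition fencode (x : nat * nat) : fstate * nat * nat :=
  ((inord x.1, false, ord0), x.2, 0).

Lemma fmachine_divide i P c j k a b u :
  onth p (val i) = Some (P, c, j, k) -> 0 < P <= W.+1 -> u < P ->
  star (tstep fmachine) ((i, false, inord u), a, b)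
    ((i, true, inord ((u + a) %% P)), 0, b + (u + a) %/ P).
Proof.
move=> pi /andP[P0 PW]; elim: a b u => [|a IH] b u uP.
  rewrite addn0 modn_small // divn_small //.
  by apply: star_step1; rewrite /= pi.
apply: star_step; first by rewrite /= pi; reflexivity.
rewrite inordK; last by exact: leq_trans uP PW.
case: eqP => [uP'|/eqP uP'].
  (* A block of [P] units is complete: the remainder restarts at 0 and the quotient grows by one. *)
  have -> : u + a.+1 = a + P by lia.
  rewrite modnDr divnDr // divnn P0.
  by have := IH (b + 1) 0 P0; rewrite add0n -addnA [1 + _]addnC.
rewrite addn0 -addSnnS; apply: IH; lia.
Qed.

Lemma fmachine_restore i P c j k a b u :
  onth p (val i) = Some (P, c, j, k) ->
  star (tstep fmachine) ((i, true, u), a, b)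
    ((inord (if u == ord0 then j else k), false, ord0),
     a + b * (if u == ord0 then c else P) + u, 0).
Proof.
move=> pi; elim: b a => [|b IH] a.
  by apply: star_step1; rewrite /= pi mul0n addn0.
apply: star_step; first by rewrite /= pi; reflexivity.
by rewrite mulSn addnA; exact: IH.
Qed.

Lemma fstep_simulation x y : star (fstep p) x y ->
  star (tstep fmachine) (fencode x) (fencode y).
Proof.
apply: star_simulation => {x y} -[i N] y /=.
case pi: (onth p i) => [[[[P c] j] k]|] // [<-].
have ip : i < size p by rewrite -onthTE pi.
have pi' : onth p (val (inord i : 'I_(size p).+2)) = Some (P, c, j, k).
  by rewrite /= inordK // ltnW // ltnW.
have PW : 0 < P <= W.+1.
  move: pW => /(@all_nthP _ _ _ (0, 0, 0, 0)) /(_ i ip).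
  move: pi; rewrite onthE (nth_map (0, 0, 0, 0)) // => -[->]; exact.
have /andP[P0 PW'] := PW.
have o0 : ord0 = inord 0 :> 'I_W.+1 by apply: val_inj; rewrite /= inordK.
have := fmachine_divide N 0 pi' PW P0; rewrite !add0n -o0 => div.
apply: star_trans div _.
have NP : N %% P < W.+1 by apply: leq_trans PW'; rewrite ltn_pmod.
have := fmachine_restore 0 (N %/ P) (inord (N %% P)) pi'.
rewrite add0n o0 -val_eqE /= !inordK // -o0 /dvdn.
case: eqP => [->|_]; first by rewrite addn0.
by rewrite -divn_eq.
Qed.

Lemma fmachine_None i b u : size p <= i -> i < (size p).+2 ->
  fmachine ((inord i, b, u)) = None.
Proof. by move=> pi ip; rewrite /fmachine inordK // onth_default. Qed.

End TwoCounterFractions.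

(** * Register programs as fraction machines *)

Lemma exists_primes :
  exists pr : nat -> nat, injective pr /\ forall i, prime (pr i).
Proof.
pose pr := fix f i := if i is j.+1 then s2val (prime_above (f j)) else 2.
exists pr; split; last by case=> [|i] //=; case: prime_above.
have inc : {homo pr : i j / i < j}.
  by apply: homo_ltn => [? ? ?|i /=]; [exact: ltn_trans|case: prime_above].
by move=> i j; case: (ltngtP i j) => // /inc; lia.
Qed.

Lemma upd_eq R r v : upd R r v r = v.
Proof. by rewrite /upd eqxx. Qed.

Lemma upd_neq R r v s : s != r -> upd R r v s = R s.
Proof. by rewrite /upd => /negPf ->. Qed.

Section Registers.
Variables (pr : nat -> nat) (K : nat).
Hypotheses (pr_inj : injective pr) (pr_prime : forall i, prime (pr i)).
Implicit Types (R : nat -> nat) (p : fractions).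

(** * Registers as exponents of primes *)

Definition godel R := \prod_(i < K) pr i ^ R i.

Lemma eq_godel R R' : R =1 R' -> godel R = godel R'.
Proof. by move=> e; apply: eq_bigr => i _; rewrite e. Qed.

Lemma godel_upd_mul R r v d : r < K ->
  godel (upd R r (v + d)) = godel (upd R r v) * pr r ^ d.
Proof.
move=> rK; rewrite /godel (bigD1 (Ordinal rK)) // [in RHS](bigD1 (Ordinal rK)) //=.
rewrite !upd_eq expnD mulnAC.
by congr (_ * _ * _); apply: eq_bigr => i ir; rewrite !upd_neq.
Qed.

Lemma upd_id R r : upd R r (R r) =1 R.
Proof. by move=> s; rewrite /upd; case: eqP => // ->. Qed.

Lemma godel_add R r d : r < K ->
  godel (upd R r (R r + d)) = godel R * pr r ^ d.
Proof. by move=> rK; rewrite godel_upd_mul // (eq_godel (upd_id R r)). Qed.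

Lemma dvdn_godel R r : r < K -> (pr r %| godel R) = (0 < R r).
Proof.
move=> rK; rewrite /godel Euclid_dvd_prod // big_has.
apply/hasP/idP => [[i _]|R0].
  rewrite Euclid_dvdX // => /andP[].
  by rewrite dvdn_prime2 // => /eqP/pr_inj ->.
exists (Ordinal rK); first by rewrite mem_index_enum.
by rewrite Euclid_dvdX //= dvdnn.
Qed.

Lemma godel_div R r n : r < K -> R r = n.+1 ->
  godel R %/ pr r = godel (upd R r n).
Proof.
move=> rK Rr; rewrite -(eq_godel (upd_id R r)) Rr -addn1 godel_upd_mul //.
by rewrite expn1 mulnK // prime_gt0.
Qed.

(** Trades one unit of register [r] for [c] units of register [s]; with [c = 0] it is a plain
    decrement. *)
Definition move_line r s c j k : nat * nat * nat * nat :=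
  (pr r, pr s ^ c, j, k).

Definition add_line r d j : nat * nat * nat * nat := (1, pr r ^ d, j, j).

Lemma fstep_move_pos p i r s c j k R n : r < K -> s < K ->
  onth p i = Some (move_line r s c j k) -> R r = n.+1 ->
  fstep p (i, godel R) =
    Some (j, godel (upd (upd R r n) s (upd R r n s + c))).
Proof.
move=> rK sK p_i Rr; rewrite /= p_i /= dvdn_godel // Rr /=.
by rewrite (godel_div rK Rr) godel_add.
Qed.

Lemma fstep_move_zero p i r s c j k R : r < K ->
  onth p i = Some (move_line r s c j k) -> R r = 0 ->
  fstep p (i, godel R) = Some (k, godel R).
Proof. by move=> rK p_i Rr; rewrite /= p_i /= dvdn_godel // Rr. Qed.

Lemma fstep_add p i r d j R : r < K -> onth p i = Some (add_line r d j) ->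
  fstep p (i, godel R) = Some (j, godel (upd R r (R r + d))).
Proof. by move=> rK p_i; rewrite /= p_i /= dvd1n divn1 godel_add. Qed.

Lemma star_move_loop p i r s c k R : r < K -> s < K -> r != s ->
  onth p i = Some (move_line r s c i k) ->
  star (fstep p) (i, godel R) (k, godel (upd (upd R r 0) s (R s + R r * c))).
Proof.
move=> rK sK rs p_i; move e: (R r) => n; elim: n R e => [|n IH] R Rr.
  apply: star_step1; rewrite (fstep_move_zero rK p_i Rr) mul0n addn0.
  congr (Some (_, _)); apply: eq_godel => t; rewrite /upd.
  by case: eqP => [->//|_]; case: eqP => [->|].
apply: star_step; first exact: fstep_move_pos p_i Rr.
set R1 := upd _ s _.
have R1r : R1 r = n by rewrite /R1 upd_neq // upd_eq.
have := IH R1 R1r.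
rewrite (@eq_godel (upd (upd R1 r 0) s _) (upd (upd R r 0) s (R s + n.+1 * c))) //.
move=> t; rewrite /R1 /upd eqxx [s == r]eq_sym (negPf rs).
by case: (t == s); [lia|case: (t == r)].
Qed.

(** Register [x] is emptied into the scratch register 0 at rate [c], then moved back at rate 1. *)
Lemma star_scale p i x c k R : 0 < K -> x < K -> x != 0 ->
  onth p i = Some (move_line x 0 c i i.+1) ->
  onth p i.+1 = Some (move_line 0 x 1 i.+1 k) -> R 0 = 0 ->
  star (fstep p) (i, godel R) (k, godel (upd R x (R x * c))).
Proof.
move=> K0 xK x0 p_i pi1 R0.
apply: star_trans (star_move_loop _ xK K0 x0 p_i) _.
have x0' : 0 != x by rewrite eq_sym.
have := star_move_loop (upd (upd R x 0) 0 (R 0 + R x * c)) K0 xK x0' pi1.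
set R1 := upd _ x (_ + _); rewrite (@eq_godel R1 (upd R x (R x * c))) //.
move=> t; rewrite /R1 /upd eqxx (negPf x0) eqxx R0 muln1.
by case: eqP => // _; case: eqP => [->|].
Qed.

(* [Lin x c d] is x := c * x + d and [MulExp x c e] is x := x * c ^ e; e := 0.
   Register 0 is scratch space and holds 0 between two operations. *)
Inductive op := Lin of nat & nat & nat | MulExp of nat & nat & nat.

Definition op_wf o :=
  match o with
  | Lin x _ _ => 0 < x < K
  | MulExp x _ e => [&& 0 < x < K, 0 < e < K & x != e]
  end.

Definition op_sem o R :=
  match o with
  | Lin x c d => upd R x (R x * c + d)
  | MulExp x c e => upd (upd R e 0) x (R x * c ^ R e)
  end.

(** Every operation takes three lines and exits at [i.+3]. Each round of [MulExp] takes one unit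
    from [e] and multiplies [x] by [c]. *)
Definition op_lines i o : fractions :=
  match o with
  | Lin x c d =>
      [:: move_line x 0 c i i.+1; move_line 0 x 1 i.+1 i.+2; add_line x d i.+3]
  | MulExp x c e =>
      [:: move_line e 0 0 i.+1 i.+3; move_line x 0 c i.+1 i.+2;
          move_line 0 x 1 i.+2 i]
  end.

Fixpoint ops_lines i os : fractions :=
  if os is o :: os' then op_lines i o ++ ops_lines i.+3 os' else [::].

Lemma size_ops_lines i os : size (ops_lines i os) = 3 * size os.
Proof. by elim: os i => //= o os IH i; rewrite size_cat IH; case: o => /=; lia. Qed.

Lemma ops_lines_pos i os : all (fun l => 0 < l.1.1.1) (ops_lines i os).
Proof.
by elim: os i => //= -[x c d|x c e] os IH i; rewrite /= !prime_gt0 //= IH.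
Qed.

Lemma op_sem0 o R : op_wf o -> op_sem o R 0 = R 0.
Proof.
case: o => [x c d|x c e] /=.
  by move=> /andP[x0 _]; rewrite upd_neq // neq_ltn x0.
by move=> /and3P[/andP[x0 _] /andP[e0 _] _]; rewrite !upd_neq // neq_ltn ?x0 ?e0.
Qed.

Lemma op_correct p i o R : op_wf o -> R 0 = 0 ->
  (forall t, t < 3 -> onth p (t + i) = onth (op_lines i o) t) ->
  star (fstep p) (i, godel R) (i.+3, godel (op_sem o R)).
Proof.
move=> + + p_i; move: (p_i 0 isT) (p_i 1 isT) (p_i 2 isT) => {p_i}.
rewrite add0n add1n add2n.
case: o => [x c d|x c e] p0 p1 p2; rewrite [op_wf _]/=.
  move=> /andP[x0 xK] R0; have K0 : 0 < K by exact: leq_ltn_trans xK.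
  have x0' : x != 0 by rewrite -lt0n.
  apply: star_trans (star_scale K0 xK x0' p0 p1 R0) _.
  apply: star_step1; rewrite (fstep_add _ xK p2) upd_eq.
  congr (Some (_, _)); apply: eq_godel => t; rewrite /= /upd.
  by case: (t == x).
move=> /and3P[/andP[x0 xK] /andP[e0 eK] xe] R0.
have K0 : 0 < K by exact: leq_ltn_trans xK.
have x0' : x != 0 by rewrite -lt0n.
have e0' : e != 0 by rewrite -lt0n.
move E: (R e) => n; elim: n R R0 E => [|n IH] R R0 Re.
  apply: star_step1; rewrite (fstep_move_zero eK p0 Re).
  congr (Some (_, _)); apply: eq_godel => t; rewrite /= /upd Re muln1.
  by case: eqP => [->//|_]; case: eqP => [->|].
apply: star_step; first exact: (fstep_move_pos eK K0 p0 Re).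
set R1 := upd _ 0 _.
have R10 : R1 0 = 0 by rewrite /R1 upd_eq upd_neq ?R0 // eq_sym.
apply: star_trans (star_scale K0 xK x0' p1 p2 R10) _.
set R2 := upd _ x _.
have R20 : R2 0 = 0 by rewrite /R2 upd_neq // eq_sym.
have R2e : R2 e = n.
  by rewrite /R2 upd_neq 1?eq_sym // /R1 upd_neq // upd_eq.
have := IH R2 R20 R2e.
rewrite (@eq_godel (op_sem (MulExp x c e) R2) (op_sem (MulExp x c e) R)) //.
move=> t; rewrite /= R2e Re /R2 /R1 /upd eqxx (negPf x0') (negPf xe).
case: (t == x); first by rewrite expnS mulnA.
case: (t == e) => //; case: (eqVneq t 0) => // ->.
by rewrite [0 == e]eq_sym (negPf e0') addn0.
Qed.

Definition ops_sem os R := foldl (fun R o => op_sem o R) R os.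

Lemma ops_correct p i os R : all op_wf os -> R 0 = 0 ->
  (forall t, t < size (ops_lines i os) ->
     onth p (t + i) = onth (ops_lines i os) t) ->
  star (fstep p) (i, godel R) (i + 3 * size os, godel (ops_sem os R)).
Proof.
elim: os i R => [|o os IH] i R /=.
  by rewrite addn0 => *; exact: star_refl.
move=> /andP[o_wf os_wf] R0 p_i.
have s3 : size (op_lines i o) = 3 by case: (o).
apply: star_trans (op_correct o_wf R0 _) _.
  by move=> t t3; rewrite p_i ?size_cat ?s3 1?onth_cat ?s3 ?t3 //; lia.
have -> : i + 3 * (size os).+1 = i.+3 + 3 * size os by lia.
apply: IH => //; first by rewrite op_sem0.
move=> t ts; have := p_i (t + 3); rewrite size_cat s3 onth_cat s3.
rewrite -addnA addnK !ifF; last by lia.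
by apply; lia.
Qed.

End Registers.

(** * The diagonal machine *)

Section Diagonal.
Variables (pr : nat -> nat) (p : program).
Hypotheses (pr_inj : injective pr) (pr_prime : forall i, prime (pr i)).

Definition instr_reg (a : instr) : nat :=
  match a with Inc r _ => r | Dec r _ _ => r end.

Definition nregs := 12 + \max_(r <- map instr_reg p) r.

(* Initially the registers 2 to 11 hold m, m, q, q, k, k, y, y, z, z.  One copy
   of each serves to compute in register 1 the initial counter value n, which is
   the prime encoding of this very initial state; the other copy then serves to
   compute in register 11 the code of the instance with initial counter n.
   Register r of p is register r + 11 here. *)
Definition self_code_ops : seq op :=
  [:: Lin 1 0 1; MulExp 1 (pr 2 * pr 3) 2; MulExp 1 (pr 4 * pr 5) 4;
      MulExp 1 (pr 6 * pr 7) 6; MulExp 1 (pr 8 * pr 9) 8;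
      MulExp 1 (pr 10 * pr 11) 10;
      MulExp 9 2 1; Lin 9 2 1; MulExp 9 2 5; Lin 9 2 1; MulExp 9 2 3;
      MulExp 11 2 9; Lin 11 2 1; MulExp 11 2 7].

Definition self_regs m q k y z : nat -> nat :=
  nth 0 [:: 0; 0; m; m; q; q; k; k; y; y; z; z].

(** The 14 operations of [self_code_ops] occupy 42 lines. All exits of [p] are merged into the line
    just after its translation, where the answer is tested. *)
Definition pline (i : nat) := 42 + minn i (size p).

Definition instr_line (a : instr) : nat * nat * nat * nat :=
  match a with
  | Inc r j => add_line pr (r + 11) 1 (pline j)
  | Dec r j k => move_line pr (r + 11) 0 0 (pline j) (pline k)
  end.

Definition accept_line := (42 + size p).+1.

(* The last line inverts the answer of p and, when accepting, empties the
   register. *)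
Definition diagonal : fractions :=
  ops_lines pr 0 self_code_ops ++ map instr_line p ++
  [:: (pr 11, 0, accept_line, accept_line.+1)].

Lemma size_diagonal : size diagonal = accept_line.
Proof.
by rewrite /diagonal size_cat size_ops_lines size_cat size_map addn1 addnS.
Qed.

(** Registers come in equal pairs, whence the bases [pr 2 * pr 3] and so on in [self_code_ops]:
    reading one copy accounts for both. *)
Lemma godel_self_regs m q k y z :
  godel pr nregs (self_regs m q k y z) =
  (pr 2 * pr 3) ^ m * (pr 4 * pr 5) ^ q * (pr 6 * pr 7) ^ k *
  (pr 8 * pr 9) ^ y * (pr 10 * pr 11) ^ z.
Proof.
rewrite /godel -(big_mkord xpredT (fun i => pr i ^ self_regs m q k y z i)).
rewrite /nregs (@big_cat_nat _ _ _ 12) //= ?leq_addr //.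
have -> b : \prod_(12 <= i < b) pr i ^ self_regs m q k y z i = 1.
  by rewrite big_nat big1 // => i /andP[i12 _]; rewrite /self_regs nth_default.
rewrite -[index_iota 0 12]/[:: 0; 1; 2; 3; 4; 5; 6; 7; 8; 9; 10; 11].
rewrite !big_cons big_nil /self_regs /=.
by rewrite !expn0 !mul1n !muln1 !expnMn !mulnA.
Qed.

(* With CodeSeq.code (x :: s) = 2 ^ x * (2 * code s + 1), the code of the
   instance with m states, initial state q, k letters and initial counter n;
   y and z are 2 * c + 1 for c the codes of the remaining parts. *)
Definition self_code m q k y z :=
  let n := godel pr nregs (self_regs m q k y z) in
  2 ^ k * (2 ^ (2 ^ m * (2 ^ q * (2 ^ n * y).*2.+1).*2.+1) * z).*2.+1.

(** This is the initial state that [p] expects: its input in register 11, and its other registers,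
    which start at 12, empty. *)
Lemma self_code_ops_sem m q k y z :
  let R := ops_sem self_code_ops (self_regs m q k y z) in
  R 11 = self_code m q k y z /\ forall r, R (r + 12) = 0.
Proof.
move=> R; split; last first.
  (* Symbolic execution: the arithmetic operations stay folded, so only register updates are
     computed. *)
  by move=> r; rewrite /R addnC; lazy -[muln addn expn]; case: r.
have -> : R 11 = (z * 2 ^ ((((y * 2 ^ ((0 * 0 + 1) *
    (pr 2 * pr 3) ^ m * (pr 4 * pr 5) ^ q * (pr 6 * pr 7) ^ k *
    (pr 8 * pr 9) ^ y * (pr 10 * pr 11) ^ z)) * 2 + 1) * 2 ^ q * 2 + 1) * 2 ^ m)
    * 2 + 1) * 2 ^ k.
  by rewrite /R; lazy -[muln addn expn].
rewrite /self_code godel_self_regs mul0n add0n mul1n.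
move: (_ * (pr 10 * pr 11) ^ z) => n.
have dS v : v.*2.+1 = v * 2 + 1 by rewrite addn1 muln2.
rewrite !dS (mulnC (2 ^ n)) (mulnC (2 ^ q)) (mulnC (2 ^ m)) (mulnC (2 ^ _) z).
by rewrite (mulnC (2 ^ k)).
Qed.

Lemma onth_diagonal_ops t : t < 42 ->
  onth diagonal t = onth (ops_lines pr 0 self_code_ops) t.
Proof. by move=> t42; rewrite onth_cat size_ops_lines t42. Qed.

Lemma onth_diagonal_instr i : i < size p ->
  onth diagonal (42 + i) = omap instr_line (onth p i).
Proof.
move=> ip; rewrite onth_cat size_ops_lines ltnNge leq_addr /= addKn.
by rewrite onth_cat size_map ip onth_map.
Qed.

Lemma onth_diagonal_last : onth diagonal (42 + size p) =
  Some (pr 11, 0, accept_line, accept_line.+1).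
Proof.
rewrite onth_cat size_ops_lines ltnNge leq_addr /= addKn.
by rewrite onth_cat size_map ltnn subnn.
Qed.

Lemma diagonal_pos : all (fun l => 0 < l.1.1.1) diagonal.
Proof.
have pr0 r : 0 < pr r by exact: prime_gt0.
rewrite /diagonal all_cat ops_lines_pos // all_cat; apply/and3P; split=> //.
  rewrite all_map (@eq_all _ _ predT) ?all_predT // => -[r j|r j k] //=.
  by rewrite pr0.
by rewrite /= pr0.
Qed.

Local Notation godel := (godel pr nregs).

Lemma reg_lt_nregs a i r : onth p i = Some a -> r = instr_reg a ->
  r + 11 < nregs.
Proof.
move=> pa ->; have ip : i < size p by rewrite -onthTE pa.
rewrite addnC /nregs ltnS leq_add2l; apply: (@leq_bigmax_seq _ _ xpredT id) => //.
move: pa; rewrite onthE (nth_map a) // => -[<-].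
by rewrite -(nth_map a 0) // mem_nth // size_map.
Qed.

(** A step inside [p] costs one fraction step; outside [p] the configuration is stationary and none
    is needed. *)
Lemma mstep_simulation c R : (forall r, R (r + 11) = c.2 r) ->
  exists R', (forall r, R' (r + 11) = (mstep p c).2 r) /\
    star (fstep diagonal) (pline c.1, godel R) (pline (mstep p c).1, godel R').
Proof.
case: c => i S /= RS; case pa: (onth p i) => [a|]; last first.
  by exists R; split=> //; exact: star_refl.
have ip : i < size p by rewrite -onthTE pa.
have line : onth diagonal (pline i) = Some (instr_line a).
  by rewrite /pline (minn_idPl (ltnW ip)) onth_diagonal_instr // pa.
have upd11 T U r v : (forall s, T (s + 11) = U s) ->
    forall s, upd T (r + 11) v (s + 11) = upd U r v s.
  by move=> TU s; rewrite /upd eqn_add2r TU.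
case: a pa line => [r j|r j k] pa line.
  exists (upd R (r + 11) (R (r + 11) + 1)); split.
    by move=> s; rewrite (upd11 _ S) // RS addn1.
  apply: star_step1; apply: fstep_add line => //.
  exact: reg_lt_nregs pa erefl.
have rK := reg_lt_nregs pa erefl.
case Sr: (S r) => [|n] /=.
  exists R; split=> //; apply: star_step1.
  by apply: fstep_move_zero line _ => //; rewrite RS.
exists (upd (upd R (r + 11) n) 0 (upd R (r + 11) n 0 + 0)); split.
  by move=> s; rewrite upd_neq ?(upd11 _ S) // -lt0n addn_gt0 orbT.
apply: star_step1; apply: fstep_move_pos line _ => //.
by rewrite RS.
Qed.

Lemma mrun_simulation t c R : (forall r, R (r + 11) = c.2 r) ->
  exists R', (forall r, R' (r + 11) = (iter t (mstep p) c).2 r) /\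
    star (fstep diagonal) (pline c.1, godel R)
      (pline (iter t (mstep p) c).1, godel R').
Proof.
elim: t => [|t IH] Rc; first by exists R; split=> //; exact: star_refl.
have [R' [R'c run]] := IH Rc; have [R'' [R''c run']] := mstep_simulation R'c.
by exists R''; split=> //; exact: star_trans run run'.
Qed.

Lemma diagonal_run m q k y z (b : bool) : outputs p (self_code m q k y z) b ->
  exists N, star (fstep diagonal) (0, godel (self_regs m q k y z))
    (if b then (accept_line, 0) else (accept_line.+1, N)).
Proof.
move=> [t /= [halt res]].
set R0 := self_regs m q k y z; pose R := ops_sem self_code_ops R0.
have [R11 R12] : R 11 = self_code m q k y z /\ forall r, R (r + 12) = 0.
  exact: self_code_ops_sem.
have prerun : star (fstep diagonal) (0, godel R0) (42, godel R).
  apply: (@ops_correct pr nregs _ _ diagonal 0 self_code_ops) => // t'.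
  by rewrite size_ops_lines addn0; exact: onth_diagonal_ops.
have start r : R (r + 11) = upd (fun=> 0) 0 (self_code m q k y z) r.
  by case: r => [|r]; rewrite ?R11 // addSnnS R12.
have [R' [R'res run]] := mrun_simulation t
  (c := (0, upd (fun=> 0) 0 (self_code m q k y z))) start.
move: run; rewrite /pline (minn_idPr halt) min0n addn0 => run.
exists (godel R'); apply: star_trans (star_trans prerun run) _.
have := R'res 0; rewrite add0n res => R'11.
(* The answer, 0 or 1, sits in register 11, so divisibility by [pr 11] reads it. *)
apply: star_step1; rewrite /fstep onth_diagonal_last dvdn_godel // R'11.
by case: b R'11 {res} => //= _; rewrite muln0.
Qed.

End Diagonal.

Theorem theorem2 (F : forall Sigma : finType, set (language Sigma))
  (F_definite : forall Sigma : finType, @definite Sigma `<=` F Sigma) :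
  ~ algorithmically_decidable code_oca_pair
      (fun I : oca_pair =>
         separable (F 'I_(alphabet_size I))
                   (oca_lang (fst_oca I)) (oca_lang (snd_oca I))).
Proof.
move=> [p decides]; have [pr [pr_inj pr_prime]] := exists_primes.
pose D := diagonal pr p; pose W := \max_(l <- D) l.1.1.1.
have DW : all (fun l => 0 < l.1.1.1 <= W.+1) D.
  apply/allP => l lD; rewrite (allP (diagonal_pos p pr_prime)) //=.
  by apply: leqW; exact: (leq_bigmax_seq l).
pose M := @fmachine D W.
pose q0 := (fencode D W (0, 0)).1.1.
pose qf := (fencode D W (accept_line p, 0)).1.1.
(* Transitions and zero tests do not depend on the initial counter value, so 0 can stand for [n].
   The constants below are thus fixed before [n] is defined from them. *)
pose A s := side M s q0 0 qf.
pose tail s := [:: val (enum_rank qf); 0;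
  CodeSeq.code (map (@code_trans _ _) (oca_trans (A s)));
  CodeSeq.code (map (@code_ztest _ _) (oca_ztests (A s)))].
pose m := #|{: 'I_(size D).+2 * bool * 'I_W.+1}|.
pose k := #|{: 'I_(size D).+2 * bool * 'I_W.+1 * bool}|.
pose q : nat := val (enum_rank q0).
pose y := (CodeSeq.code (tail true)).*2.+1.
pose z := (CodeSeq.code [:: CodeSeq.code [:: m, q, 0 & tail false]]).*2.+1.
pose n := godel pr (nregs p) (self_regs m q k y z).
pose I := side_pair M q0 n qf.
have codeI : code_oca_pair I = self_code pr p m q k y z by [].
have [b [out sepP]] := decides I; rewrite codeI in out.
have [N run] := diagonal_run pr_inj pr_prime out.
have {}run := fstep_simulation DW run.
have sizeD : size D = accept_line p by exact: size_diagonal.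
have Mqf : M qf = None by apply: fmachine_None; rewrite sizeD.
case: b sepP {out} run => sepP run.
  (* The answer yes claims separability, yet it makes the machine accept, which puts a common word
     in both languages. *)
  exact: (accept_not_separable (F := F) run) (sepP.2 isT).
suff : is_true false by [].
apply/sepP; apply: reject_separable run _ _ Mqf => //.
  by rewrite /tstep /fencode /M fmachine_None // sizeD.
have acc : accept_line p < (size D).+2 by rewrite sizeD.
have rej : (accept_line p).+1 < (size D).+2 by rewrite sizeD.
by rewrite !xpair_eqE -!val_eqE /= (inordK acc) (inordK rej) gtn_eqF.
Qed.
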